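(* There exists an absolute constant $c>0$ such that the following holds for all positive integers $N, K, d$ with $K\ge N$, every set $\Omega\subseteq\mathbb{R}^d$, and every $K$-tuple of linearly independent functions $\varphi_1,\dots,\varphi_K:\Omega\to\mathbb{C}$. Let $\mathcal{F}_K(\Omega)=\mathrm{span}\{\varphi_1,\dots,\varphi_K\}$. If $f\in\bigotimes^N\mathcal{F}_K(\Omega)$ is antisymmetric and $f\neq 0$, then $$\mathrm{rank}_{\mathcal{F}_K(\Omega)}(f)\ \ge\ c\,\frac{2^N}{\sqrt{N}}.$$
   Context: All functions are complex-valued and spans are over $\mathbb{C}$. For functions $\psi_1,\dots,\psi_N$ on $\Omega$, $\bigotimes_{j=1}^N\psi_j$ is the function on $\Omega^N$ given by $(\bigotimes_{j=1}^N\psi_j)(r_1,\dots,r_N)=\prod_{j=1}^N\psi_j(r_j)$. For a linear space $\mathcal{B}$ of functions on $\Omega$, $\bigotimes^N\mathcal{B}$ is the set of all functions on $\Omega^N$ of the form $f=\sum_{i=1}^p\bigotimes_{j=1}^N\psi_{ij}$ with $p\in\mathbb{N}$ and $\psi_{ij}\in\mathcal{B}$ (no closure is taken). The TPF (tensor product function) rank $\mathrm{rank}_{\mathcal{B}}(f)$ of $f\in\bigotimes^N\mathcal{B}$ is the minimum $p\in\mathbb{N}$ such that $f=\sum_{i=1}^p\bigotimes_{j=1}^N\psi_{ij}$ for some $\psi_{ij}\in\mathcal{B}$. A function $f$ on $\Omega^N$ is antisymmetric if $f(r_1,\dots,r_N)=\mathrm{sgn}(\pi)f(r_{\pi(1)},\dots,r_{\pi(N)})$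 for all permutations $\pi$ of $\{1,\dots,N\}$ and all $(r_1,\dots,r_N)\in\Omega^N$. *)

(* Defs.v *)
From HB Require Import structures.
From mathcomp Require Import all_boot all_order all_algebra all_fingroup.
From mathcomp Require Import complex.
From mathcomp Require Import boolp classical_sets reals.

Set Implicit Arguments.
Unset Strict Implicit.
Unset Printing Implicit Defensive.

Import Order.TTheory GRing.Theory Num.Theory.
Local Open Scope classical_set_scope.
Local Open Scope ring_scope.
Local Open Scope complex_scope.

Definition lincomb (R : realType) (T : Type) (K : nat)
    (a : 'I_K -> R[i]) (phi : 'I_K -> T -> R[i]) : T -> R[i] :=
  fun r => \sum_(k < K) a k * phi k r.

Definition fun_span (R : realType) (T : Type) (K : nat)
    (phi : 'I_K -> T -> R[i]) : set (T -> R[i]) :=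
  [set psi | exists a : 'I_K -> R[i], psi = lincomb a phi].

Definition lin_indep (R : realType) (T : Type) (K : nat)
    (phi : 'I_K -> T -> R[i]) : Prop :=
  forall a : 'I_K -> R[i], lincomb a phi = (fun=> 0) -> forall k, a k = 0.

(* The N-fold Cartesian power of T is represented by 'I_N -> T. *)
Definition tensor_prod (R : realType) (T : Type) (N : nat)
    (psi : 'I_N -> T -> R[i]) : ('I_N -> T) -> R[i] :=
  fun r => \prod_(j < N) psi j (r j).

Definition tensor_sum (R : realType) (T : Type) (N : nat)
    (B : set (T -> R[i])) (f : ('I_N -> T) -> R[i]) (p : nat) : Prop :=
  exists psi : 'I_p -> 'I_N -> T -> R[i],
    (forall i j, B (psi i j)) /\
    f = (fun r => \sum_(i < p) tensor_prod (psi i) r).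

Definition tensor_power (R : realType) (T : Type) (N : nat)
    (B : set (T -> R[i])) : set (('I_N -> T) -> R[i]) :=
  [set f | exists p, tensor_sum B f p].

(* The value 0 outside tensor_power B is a junk value. *)
Definition tpf_rank (R : realType) (T : Type) (N : nat)
    (B : set (T -> R[i])) (f : ('I_N -> T) -> R[i]) : nat :=
  if pselect (exists p, `[< tensor_sum B f p >]) is left ex_p
  then ex_minn ex_p else 0%N.

Definition antisymmetric_fun (R : realType) (T : Type) (N : nat)
    (f : ('I_N -> T) -> R[i]) : Prop :=
  forall (s : 'S_N) (r : 'I_N -> T),
    f r = (-1) ^+ odd_perm s * f (fun j => r (s j)).

(* Main.v *)
Require Import Defs.
From mathcomp Require Import all_boot all_order all_algebra all_fingroup.
From mathcomp Require Import complex.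
From mathcomp Require Import boolp classical_sets reals.
From mathcomp Require Import zify.

(** The idea is to read off from [f] a matrix that is visibly of large rank.
    Fix [r = (r_1, ..., r_N)] with [f r != 0] and evaluate [f] only at points
    whose coordinates are among the [r_j].  By antisymmetry these values form
    the Levi-Civita tensor up to the factor [f r]: a repeated coordinate gives
    [0] ([antisymmetric_eq0]), a rearrangement of [r] gives a nonzero value
    ([antisymmetric_perm_neq0]).

    Cut the [N] slots into the first [m] and the remaining [N - m].  For
    [m]-subsets [S] and [T] of the index set, fill the first slots with [S] and
    the others with the complement of [T].  Some index is used twice unless
    [S = T], so the matrix of the resulting values of [f], indexed by [(S, T)],
    is diagonal with nonzero diagonal, and its rank is ['C(N, m)].  A sum of [p]
    tensor products, on the other hand, splits slot by slot into factors
    depending on [S] alone and factors depending on [T] alone, so the same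
    matrix is a product of matrices of inner size [p].  Hence ['C(N, m) <= p]
    ([antisymmetric_tensor_sum_bin]).

    Taking [m = N./2] and the elementary estimate [4 ^ N <= 4 N 'C(N, N./2) ^ 2]
    ([expn4_central_bin]) gives the bound with [c = 1/2]. *)

Set Implicit Arguments.
Unset Strict Implicit.
Unset Printing Implicit Defensive.

Import Order.TTheory GRing.Theory Num.Theory.
Local Open Scope classical_set_scope.
Local Open Scope ring_scope.
Local Open Scope complex_scope.

Lemma bin_double_succ n :
  (n.+1 * 'C(n.+1.*2, n.+1) = (n.*2.+1).*2 * 'C(n.*2, n))%N.
Proof.
have odd_step : (n.+1 * 'C(n.*2.+1, n) = n.*2.+1 * 'C(n.*2, n))%N.
  rewrite (mul_bin_diag n.*2.+1 n) mul_bin_left.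
  by congr (_ * _)%N; lia.
have sym : 'C(n.*2.+1, n.+1) = 'C(n.*2.+1, n).
  by rewrite -bin_sub; [congr (binomial _ _); lia | lia].
by rewrite doubleS binS sym addnn -doubleMr odd_step doubleMl.
Qed.

(** Induction on [n]: passing from [n] to [n.+1] multiplies the square of the
    central binomial coefficient by [4 (2n + 1)^2 / (n + 1)^2], and
    [(2n + 1)^2 >= 4 n (n + 1)]. *)
Lemma expn16_bin_double n :
  (0 < n)%N -> (16 ^ n <= 4 * n * 'C(n.*2, n) ^ 2)%N.
Proof.
elim: n => // -[_ _ //|n IHn _].
have {IHn} := IHn isT; have := bin_double_succ n.+1.
move: 'C(_, _) 'C(_, _) => a b step IH.
rewrite expnS -(leq_pmul2r (ltn0Sn n.+1)).
have -> : (4 * n.+2 * b ^ 2 * n.+2 = 4 * (n.+2 * b) ^ 2)%N by nia.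
rewrite step; apply: (@leq_trans (16 * (4 * n.+1 * a ^ 2) * n.+2)%N).
  by rewrite !leq_mul2r leq_mul2l IH !orbT.
have -> : (16 * (4 * n.+1 * a ^ 2) * n.+2 = 64 * (n.+1 * n.+2) * a ^ 2)%N by nia.
have -> : (4 * ((n.+1).*2.+1.*2 * a) ^ 2
           = 16 * (n.+1).*2.+1 ^ 2 * a ^ 2)%N by nia.
by rewrite leq_mul2r; apply/orP; right; nia.
Qed.

Lemma expn4_central_bin N :
  (0 < N)%N -> (4 ^ N <= 4 * N * 'C(N, N./2) ^ 2)%N.
Proof.
move=> N_gt0; rewrite -{1 2 3}(odd_double_half N).
have exp4_double k : (4 ^ k.*2 = 16 ^ k)%N by rewrite -mul2n expnM.
case: (boolP (odd N)) => [_|evenN]; last first.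
  rewrite !add0n exp4_double.
  apply: (leq_trans (expn16_bin_double _)); first by lia.
  by rewrite leq_mul2r; apply/orP; right; lia.
(* The odd case comes from the next even one: 'C(2n + 2, n + 1) is twice
   'C(2n + 1, n). *)
move: N./2 => n.
have := expn16_bin_double (ltn0Sn n).
have sym : 'C(n.*2.+1, n.+1) = 'C(n.*2.+1, n).
  by rewrite -bin_sub; [congr (binomial _ _); lia | lia].
rewrite doubleS binS sym addnn add1n !expnS exp4_double.
move: (16 ^ n)%N 'C(_, _) => e a; rewrite !expn0 !muln1; nia.
Qed.

Section AntisymmetricFunctions.

Variables (R : realType) (T : Type) (N : nat) (f : ('I_N -> T) -> R[i]).
Hypothesis f_anti : antisymmetric_fun f.

Lemma antisymmetric_eq0 (r : 'I_N -> T) (j k : 'I_N) :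
  j != k -> r j = r k -> f r = 0.
Proof.
move=> neq_jk eq_r; have := f_anti (tperm j k) r.
have -> : (fun l => r (tperm j k l)) = r.
  by apply/funext => l; case: tpermP => // ->.
rewrite odd_tperm neq_jk expr1 mulN1r => /eqP.
by rewrite -addr_eq0 -mulr2n mulrn_eq0 /= => /eqP.
Qed.

Lemma antisymmetric_perm_neq0 (r : 'I_N -> T) (h : 'I_N -> 'I_N) :
  injective h -> f r != 0 -> f (r \o h) != 0.
Proof.
move=> h_inj; apply: contraNneq => fh0.
have := f_anti (perm h_inj) r.
have -> : (fun j => r (perm h_inj j)) = r \o h.
  by apply/funext => j /=; rewrite permE.
by rewrite fh0 mulr0 => ->.
Qed.

End AntisymmetricFunctions.

(** When [S] and [S'] have the same size, the concatenated list has size [N],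
    so the default value [j] is never reached. *)
Definition fill N (S S' : {set 'I_N}) (j : 'I_N) : 'I_N :=
  nth j (enum S ++ enum (~: S')) j.

Section Fill.

Variables (N m : nat) (S S' : {set 'I_N}).
Hypotheses (cardS : #|S| = m) (cardS' : #|S'| = m).

Lemma size_fill : size (enum S ++ enum (~: S')) = N.
Proof.
by rewrite size_cat -!cardE cardS -cardS' cardsC card_ord.
Qed.

Lemma fill_left (j : 'I_N) : (j < m)%N -> fill S S' j = nth j (enum S) j.
Proof. by move=> lt_jm; rewrite /fill nth_cat -cardE cardS lt_jm. Qed.

Lemma fill_right (j : 'I_N) : ~~ (j < m)%N -> fill S S' j = nth j (enum (~: S')) (j - m).
Proof.
by move=> /negbTE ge_jm; rewrite /fill nth_cat -cardE cardS ge_jm.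
Qed.

Lemma fill_inj : S = S' -> injective (fill S S').
Proof.
move=> eqS j k; rewrite /fill => eq_jk; apply/ord_inj/eqP.
have us : uniq (enum S ++ enum (~: S')).
  rewrite cat_uniq !enum_uniq andbT /= -eqS.
  by apply/hasPn => x; rewrite !mem_enum inE.
rewrite -(nth_uniq j _ _ us) ?size_fill //.
by rewrite eq_jk (set_nth_default k j) ?size_fill.
Qed.

(** Two distinct sets of equal size are incomparable, so some element of [S]
    lies in the complement of [S'] and is listed in both halves. *)
Lemma fill_collision :
  S <> S' -> exists j k, j != k /\ fill S S' j = fill S S' k.
Proof.
move=> neqS; have /subsetPn[x xS xnS'] : ~~ (S \subset S').
  apply/negP => sub; apply: neqS; apply/eqP.
  by rewrite eqEcard sub cardS cardS' leqnn.
have xE : x \in enum S by rewrite mem_enum.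
have xE' : x \in enum (~: S') by rewrite mem_enum inE.
have lt1 : (index x (enum S) < m)%N by rewrite -cardS cardE index_mem.
have lt2 : (m + index x (enum (~: S')) < N)%N.
  by rewrite -[X in (_ < X)%N]size_fill size_cat -cardE cardS ltn_add2l index_mem.
have lt1' : (index x (enum S) < N)%N by lia.
exists (Ordinal lt1'), (Ordinal lt2); split.
  by rewrite -val_eqE /= ltn_eqF // (leq_trans lt1) ?leq_addr.
rewrite fill_left // nth_index // fill_right /= ?addKn ?nth_index //.
by rewrite -leqNgt leq_addr.
Qed.

End Fill.

(** This is the flattening argument: the rank of the matrix [M] of values of
    [f] is ['C(N, m)] by antisymmetry, and at most [p] because each of the [p]
    products separates the two groups of slots. *)
Lemma antisymmetric_tensor_sum_bin (R : realType) (T : Type) (N m p : nat)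
    (B : set (T -> R[i])) (f : ('I_N -> T) -> R[i]) :
  tensor_sum B f p -> antisymmetric_fun f -> f <> (fun=> 0) -> ('C(N, m) <= p)%N.
Proof.
move=> [psi [_ f_sum]] f_anti f_neq0.
have [r fr_neq0] : exists r, f r != 0.
  apply: contrapT => f0; apply: f_neq0; apply/funext => r.
  by apply/eqP/negPn/negP => fr; apply: f0; exists r.
pose A := [set S : {set 'I_N} | #|S| == m]%SET.
have cardA : #|A| = 'C(N, m) by rewrite card_draws card_ord.
pose s (a : 'I_#|A|) : {set 'I_N} := enum_val a.
have card_s a : #|s a| = m by have := enum_valP a; rewrite inE => /eqP.
pose M : 'M[R[i]]_#|A| := \matrix_(a, b) f (r \o fill (s a) (s b)).
pose L : 'M[R[i]]_(#|A|, p) :=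
  \matrix_(a, i) \prod_(j < N | (j < m)%N) psi i j (r (nth j (enum (s a)) j)).
pose Q : 'M[R[i]]_(p, #|A|) :=
  \matrix_(i, b) \prod_(j < N | ~~ (j < m)%N)
                   psi i j (r (nth j (enum (~: s b)) (j - m))).
have M_fact : M = L *m Q.
  apply/matrixP => a b; rewrite !mxE f_sum; apply: eq_bigr => i _.
  rewrite /tensor_prod !mxE (bigID (fun j : 'I_N => (j < m)%N)) /=.
  congr (_ * _); apply: eq_bigr => j j_m.
    by rewrite (fill_left _ (card_s a)).
  by rewrite (fill_right _ (card_s a)).
have M_diag : M = diag_mx (\row_a M a a).
  apply/matrixP => a b; rewrite !mxE; have [-> //|neq_ab] := eqVneq a b.
  have neq_s : s a <> s b by move/enum_val_inj/eqP; rewrite (negbTE neq_ab).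
  have [j [k [neq_jk eq_jk]]] := fill_collision (card_s a) (card_s b) neq_s.
  by rewrite mulr0n (antisymmetric_eq0 f_anti neq_jk) //= eq_jk.
have M_unit : M \in unitmx.
  rewrite unitmxE M_diag det_diag unitfE; apply/prodf_neq0 => a _.
  rewrite !mxE; apply: (antisymmetric_perm_neq0 f_anti) => //.
  exact: (fill_inj (card_s a) (card_s a)).
by rewrite -cardA -(mxrank_unit M_unit) M_fact mulmx_max_rank.
Qed.

Lemma tpf_rank_tensor_sum (R : realType) (T : Type) (N : nat)
    (B : set (T -> R[i])) (f : ('I_N -> T) -> R[i]) :
  tensor_power B f -> tensor_sum B f (tpf_rank B f).
Proof.
move=> [p fp]; rewrite /tpf_rank; case: pselect => [ex_p|[]].
  by case: ex_minnP => q /asboolP.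
by exists p; apply/asboolP.
Qed.

Lemma half_exp2_sqrt_central_bin (R : realType) (N : nat) : (0 < N)%N ->
  2^-1 * (2 ^+ N / Num.sqrt N%:R) <= 'C(N, N./2)%:R :> R.
Proof.
move=> N_gt0; have sqrt_gt0 : 0 < Num.sqrt N%:R :> R by rewrite sqrtr_gt0 ltr0n.
rewrite mulrA ler_pdivrMr // ler_pdivrMl ?ltr0n //.
rewrite -(@ler_pXn2r _ 2) ?nnegrE ?mulr_ge0 ?exprn_ge0 ?ler0n ?sqrtr_ge0 //.
rewrite !exprMn sqr_sqrtr ?ler0n // -exprM mulnC exprM -!natrX -!natrM ler_nat.
by apply: leq_trans (expn4_central_bin N_gt0) _; nia.
Qed.

Theorem corollary3p3 (R : realType) :
  exists c : R, 0 < c /\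
    forall (N K d : nat), (0 < N)%N -> (0 < K)%N -> (0 < d)%N -> (N <= K)%N ->
    forall (Omega : set 'rV[R]_d) (phi : 'I_K -> set_type Omega -> R[i]),
      lin_indep phi ->
    forall f : ('I_N -> set_type Omega) -> R[i],
      tensor_power (fun_span phi) f ->
      antisymmetric_fun f ->
      f <> (fun=> 0) ->
      c * (2 ^+ N / Num.sqrt N%:R) <= (tpf_rank (fun_span phi) f)%:R.
Proof.
exists 2^-1; split; first by rewrite invr_gt0 ltr0n.
move=> N K d N_gt0 _ _ _ Omega phi _ f f_tensor f_anti f_neq0.
apply: le_trans (half_exp2_sqrt_central_bin R N_gt0) _; rewrite ler_nat.
exact: antisymmetric_tensor_sum_bin (tpf_rank_tensor_sum f_tensor) f_anti f_neq0.
Qed.
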